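(* Let $\delta := 1 - \frac{1+\log\log 2}{\log 2}$ (so $\delta \approx 0.0860713$), and fix $\delta'$ with $0<\delta'<\delta$. There is a constant $C>0$ (depending only on $\delta'$) such that whenever $x$ and $m$ are such that $m$ is an integer with $3 \leq m \leq x$, the number of natural numbers $n \leq x$ for which $T^n-1$ has a divisor of degree $m$ in $\mathbf{Q}[T]$ is at most $C\, x/(\log m)^{\delta'}$. *)

(* Defs.v *)
From mathcomp Require Import all_boot all_order all_algebra finmap.
From mathcomp Require Import boolp classical_sets functions cardinality.
From mathcomp Require Import reals exp.

Set Implicit Arguments.
Unset Strict Implicit.
Unset Printing Implicit Defensive.

Import Order.TTheory GRing.Theory Num.Theory.
Local Open Scope classical_set_scope.
Local Open Scope ring_scope.

Definition delta (R : realType) : R := 1 - (1 + ln (ln 2)) / ln 2.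

(* A polynomial [d] has degree [m] when [size d = m.+1]; [size 0 = 0], so the
   zero polynomial has no degree. *)
Definition has_divisor_of_degree (n m : nat) : Prop :=
  exists d : {poly rat}, size d = m.+1 /\ (d %| 'X^n - 1).

(* Natural numbers are positive here: for [n = 0], ['X^n - 1] is the zero
   polynomial, which every polynomial divides. *)
Definition good_exponents (R : realType) (x : R) (m : nat) : set nat :=
  [set n : nat | [/\ (0 < n)%N, n%:R <= x & has_divisor_of_degree n m]].

(* [fset_set] is the empty set on infinite sets; this lemma shows that the
   default value is never used for [good_exponents]. *)
Lemma good_exponents_finite (R : realType) (x : R) (m : nat) :
  finite_set (good_exponents x m).
Proof.
apply: (@sub_finite_set _ _ `I_(Num.truncn x).+1); last exact: finite_II.
move=> n [n_gt0 le_nx _] /=; rewrite ltnS.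
have x_ge0 : 0 <= x by apply: le_trans le_nx; rewrite ler0n.
by rewrite truncn_ge_nat.
Qed.

Definition num_good_exponents (R : realType) (x : R) (m : nat) : nat :=
  #|` fset_set (good_exponents x m)|%fset.

(* Main.v *)
Require Import Defs.
From mathcomp Require Import all_boot all_order all_algebra.
From mathcomp Require Import reals exp.
From mathcomp Require Import finmap boolp classical_sets cardinality sequences.
From mathcomp Require Import algC cyclotomic.
From mathcomp Require Import ring lra.

(* By irreducibility of the cyclotomic polynomials, [T^n - 1] has a divisor of
   degree [m] iff [m] is a sum of [phi d] over a set [D] of divisors of [n].
   Let [w = 1 / ln 2] and let [Omega n] count the prime factors of [n] up to
   [m + 1]; these contain all the prime factors of the members of [D].

   A Markov bound on the [w ^ Omega n] shows that [Omega n > (1 - t) w ln ln m]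
   for at most [O (x / (ln m) ^ delta')] integers [n <= x], for [t] small: the
   exponent [w ln w - w + 1] is [delta].  For the other [n], there are at most
   [(ln m) ^ (1 - t)] divisors [d] with [phi d <= m].  They cannot all be smooth
   for [Q = exp ((ln m) ^ (1 - t / 2))], otherwise they would be too small to
   add up to [m].  Hence [n = k P] with a prime [P > Q] dividing a member of [D];
   for [P] not dividing [k], [m = a + (P - 1) b] with [b > 0] and [a], [b] subset
   sums of the [phi d], [d | k].  So [k <= x / Q] and two subsets of a set of size
   [(ln m) ^ (1 - t)] determine [n], which leaves very few [n].

   The moment bound needs [sum_(p <= y) 1 / p <= (1 + t) ln ln y + O (1)].  By
   Rankin's trick, it suffices to compare the Euler product at
   [1 + e / ln y] with the zeta series. *)

Set Implicit Arguments.
Unset Strict Implicit.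
Unset Printing Implicit Defensive.

Import Order.TTheory GRing.Theory Num.Theory.

(** * Recovering the exponent from a cofactor *)

(* The number of prime factors of [n] up to [y], with multiplicity: [logn p n] is
   [0] when [p] is not prime. *)
Definition Omega_le (y n : nat) : nat := \sum_(p < y.+1) logn p n.

Lemma Omega_leM y a b : 0 < a -> 0 < b ->
  Omega_le y (a * b) = Omega_le y a + Omega_le y b.
Proof.
by move=> a_gt0 b_gt0; rewrite -big_split; apply: eq_bigr => p _; rewrite lognM.
Qed.

Lemma Omega_le_prime y p : prime p -> p <= y -> Omega_le y p = 1.
Proof.
move=> p_pr le_py; rewrite -ltnS in le_py.
rewrite /Omega_le (bigD1 (Ordinal le_py)) //= logn_prime // eqxx big1 // => q.
by rewrite -val_eqE /= logn_prime // => /negbTE ->.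
Qed.

Lemma Omega_le_dvd y d n : 0 < n -> d %| n -> Omega_le y d <= Omega_le y n.
Proof. by move=> n_gt0 dn; apply: leq_sum => p _; apply: dvdn_leq_log. Qed.

Definition smooth y : nat_pred := [pred p | p <= y].

(** Each prime factor [p <= y] at most doubles the count: a smooth divisor of [k' * p] divides [k']
    or is [p] times a smooth divisor of [k']. *)
Lemma size_smooth_divisors y k : 0 < k ->
  size [seq d <- divisors k | (smooth y).-nat d] <= 2 ^ Omega_le y k.
Proof.
elim/ltn_ind: k => k IHk k_gt0.
have [/existsP[p /andP[p_pr p_dvd]]|no_p] :=
    boolP [exists p : 'I_y.+1, prime p && (p %| k)]; last first.
  rewrite (@leq_trans 1) ?expn_gt0 //.
  have <- : size [:: 1] = 1 by [].
  rewrite uniq_leq_size ?filter_uniq ?divisors_uniq // => d.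
  rewrite mem_filter -dvdn_divisors // inE => /andP[/pnatP d_smooth d_dvd].
  have d_gt0 := dvdn_gt0 k_gt0 d_dvd.
  apply: contraR no_p => d_neq1.
  have d_gt1 : 1 < d by case: (d) d_gt0 d_neq1 => [|[]].
  have le_py := d_smooth d_gt0 _ (pdiv_prime d_gt1) (pdiv_dvd d).
  apply/existsP; exists (Ordinal (le_py : pdiv d < y.+1)).
  by rewrite /= pdiv_prime // (dvdn_trans (pdiv_dvd d)).
have p_gt0 := prime_gt0 p_pr; have le_py : p <= y by rewrite -ltnS ltn_ord.
move: p_dvd k_gt0 IHk => /dvdnP[k' ->].
rewrite muln_gt0 => /andP[k'_gt0 _] IHk.
have {}IHk := IHk k' (ltn_Pmulr (prime_gt1 p_pr) k'_gt0) k'_gt0.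
rewrite Omega_leM // (Omega_le_prime p_pr) // addn1 expnS mul2n -addnn.
rewrite (leq_trans _ (leq_add IHk IHk)) //.
set s := filter _ (divisors k').
have <- : size (s ++ map (muln p) s) = size s + size s by rewrite size_cat size_map.
rewrite uniq_leq_size ?filter_uniq ?divisors_uniq // => d.
rewrite mem_filter -dvdn_divisors ?muln_gt0 ?k'_gt0 // mem_cat => /andP[d_smooth d_dvd].
have [/dvdnP[e dE]|p_ndvd] := boolP (p %| d).
  have e_dvd : e %| k' by rewrite -(@dvdn_pmul2r p) // -dE.
  apply/orP; right; rewrite dE mulnC map_f // mem_filter -dvdn_divisors // e_dvd andbT.
  by move: d_smooth; rewrite dE pnatM => /andP[].
rewrite Gauss_dvdl ?(coprime_sym d) ?prime_coprime // in d_dvd.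
by rewrite mem_filter d_smooth -dvdn_divisors // d_dvd.
Qed.

(** As [d] is [y]-smooth, [Omega_le y d] counts all its prime factors, and each of them is at most
    [Q]. *)
Lemma leq_expn_Omega_le y Q d : 0 < d -> (smooth y).-nat d -> (smooth Q).-nat d ->
  d <= Q ^ Omega_le y d.
Proof.
elim/ltn_ind: d => d IHd d_gt0 smd smQd.
have [d_le1|d_gt1] := leqP d 1.
  have -> : d = 1 by apply/eqP; rewrite eqn_leq d_le1.
  by rewrite /Omega_le big1 // => p _; rewrite logn1.
have [p p_pr /dvdnP[e dE]] : exists2 p, prime p & p %| d.
  by exists (pdiv d); rewrite ?pdiv_prime ?pdiv_dvd.
have p_gt0 := prime_gt0 p_pr.
move: d_gt0 d_gt1 smd smQd IHd; rewrite dE !pnatM !(pnatE _ p_pr).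
rewrite muln_gt0 => /andP[e_gt0 _] _ /andP[sme le_py] /andP[smQe le_pQ] IHd.
rewrite Omega_leM // (Omega_le_prime p_pr) // addn1 expnSr leq_mul //.
by apply: IHd => //; rewrite ltn_Pmulr // prime_gt1.
Qed.

Lemma totient_leq n : totient n <= n.
Proof.
rewrite totient_count_coprime -[leqRHS]subn0 -[leqRHS]muln1 -sum_nat_const_nat.
by apply: leq_sum => i _; apply: leq_b1.
Qed.

Lemma leq_pred_prime_totient p d : prime p -> 0 < d -> p %| d -> p.-1 <= totient d.
Proof.
move=> p_pr d_gt0 p_dvd.
have [e co_pe dE] := pfactor_coprime p_pr d_gt0.
have lp : 0 < logn p d by rewrite logn_gt0 mem_primes p_pr d_gt0.
have e_gt0 : 0 < e by move: d_gt0; rewrite dE muln_gt0 => /andP[].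
rewrite dE totient_coprime; last by rewrite coprimeXr // coprime_sym.
rewrite totient_pfactor // mulnCA leq_pmulr //.
by rewrite muln_gt0 totient_gt0 e_gt0 expn_gt0 prime_gt0.
Qed.

Definition small_divisors m k := [seq d <- divisors k | totient d <= m].

Lemma mem_small_divisors m k d : 0 < k ->
  (d \in small_divisors m k) = (totient d <= m) && (d %| k).
Proof. by move=> k_gt0; rewrite mem_filter -dvdn_divisors. Qed.

(** A prime [p] dividing [d] has [p - 1 <= totient d <= m], whence the cutoff [m + 1]. *)
Lemma small_divisor_smooth m d : 0 < d -> totient d <= m -> (smooth m.+1).-nat d.
Proof.
move=> d_gt0 le_dm; apply/pnatP => // p p_pr p_dvd.
rewrite !inE -(prednK (prime_gt0 p_pr)) ltnS.
exact: leq_trans (leq_pred_prime_totient p_pr d_gt0 p_dvd) le_dm.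
Qed.

Lemma size_small_divisors m k : 0 < k ->
  size (small_divisors m k) <= 2 ^ Omega_le m.+1 k.
Proof.
move=> k_gt0; apply: leq_trans (size_smooth_divisors m.+1 k_gt0).
rewrite uniq_leq_size ?filter_uniq ?divisors_uniq // => d.
rewrite !mem_filter -dvdn_divisors // => /andP[le_dm d_dvd].
by rewrite d_dvd andbT small_divisor_smooth // (dvdn_gt0 k_gt0).
Qed.

Definition masked_sum (g : nat -> nat) (b : bitseq) m k :=
  \sum_(d <- mask b (small_divisors m k)) g d.

(** Padding the masks to the fixed length [M] makes them range over a type with [2 ^ M] elements,
    whatever [k] is. *)
Lemma masked_sum_exists (g : nat -> nat) m k M (s : seq nat) :
    size (small_divisors m k) <= M -> uniq s -> {subset s <= small_divisors m k} ->
  exists b : M.-tuple bool, \sum_(d <- s) g d = masked_sum g b m k.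
Proof.
move=> le_M uniq_s sub_s; set t := small_divisors m k in le_M sub_s *.
pose b := map (mem s) t ++ nseq (M - size t) false.
have size_b : size b == M by rewrite size_cat size_map size_nseq subnKC.
exists (Tuple size_b); rewrite /masked_sum -/t.
have -> : mask (Tuple size_b) t = filter (mem s) t.
  by rewrite /= /b -[t in mask _ t]cats0 mask_cat ?size_map // mask0 cats0 -filter_mask.
apply: perm_big; apply: uniq_perm => //.
  by rewrite !filter_uniq // divisors_uniq.
by move=> d; rewrite mem_filter /=; case: (boolP (d \in s)) => //= /sub_s ->.
Qed.

(* Write [n = k P].  If [P] does not divide [k], then [m = a + (P - 1) b], where
   [a] and [b] are sums of totients of small divisors of [k], so [P] is
   [(m - a) / b + 1]; if [P] divides [k], then [P] is itself a small divisor. *)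
Definition rebuild m k (t : bool * bitseq * bitseq) : nat :=
  let: (b, b1, b2) := t in
  if b then k * masked_sum id b1 m k else
  k * ((m - masked_sum totient b1 m k) %/ masked_sum totient b2 m k).+1.

Lemma rebuild_exists n m Q M (D : seq nat) :
    0 < n -> 0 < Q -> subseq D (divisors n) -> \sum_(d <- D) totient d = m ->
    2 ^ Omega_le m.+1 n <= M -> M * Q ^ Omega_le m.+1 n < m ->
  exists k, exists t : bool * M.-tuple bool * M.-tuple bool,
    [/\ 0 < k, k * Q.+1 <= n & n = rebuild m k (t.1.1, val t.1.2, val t.2)].
Proof.
move=> n_gt0 Q_gt0 sub_D sumD le_M lt_m.
have uniq_D : uniq D by rewrite (subseq_uniq sub_D) ?divisors_uniq.
have dvd_D d : d \in D -> d %| n by move=> /(mem_subseq sub_D); rewrite -dvdn_divisors.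
have gt0_D d : d \in D -> 0 < d by move=> /dvd_D; apply: dvdn_gt0.
have le_D d : d \in D -> totient d <= m.
  by move=> dD; rewrite -sumD (big_rem d) //= leq_addr.
have smooth_D d : d \in D -> (smooth m.+1).-nat d.
  by move=> dD; rewrite small_divisor_smooth ?gt0_D ?le_D.
have size_D : size D <= M.
  rewrite (leq_trans _ le_M) // (leq_trans _ (size_small_divisors m n_gt0)) //.
  by rewrite uniq_leq_size // => d dD; rewrite mem_small_divisors // le_D ?dvd_D.
(* If all of [D] were [Q]-smooth, at most [M] terms of size at most [Q ^ Omega_le m.+1 n] would add
   up to [m], against [lt_m]. *)
have [d dD d_rough] : exists2 d, d \in D & ~~ (smooth Q).-nat d.
  apply/hasP; apply: contraLR lt_m; rewrite -leqNgt -all_predC => /allP all_smooth.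
  apply: (@leq_trans (\sum_(d <- D) Q ^ Omega_le m.+1 n)); last first.
    by rewrite big_const_seq count_predT iter_addn_0 mulnC leq_mul2r size_D orbT.
  rewrite -[leqLHS]sumD big_seq [leqRHS]big_seq; apply: leq_sum => d dD.
  rewrite (leq_trans (totient_leq d)) //.
  have smQd : (smooth Q).-nat d by have := all_smooth d dD; rewrite /= negbK.
  apply: leq_trans (leq_expn_Omega_le (gt0_D d dD) (smooth_D d dD) smQd) _.
  apply: leq_pexp2l => //; apply: Omega_le_dvd => //; exact: dvd_D.
have {d_rough} [P [P_pr P_dvd lt_QP]] : exists P, [/\ prime P, P %| d & Q < P].
  move: d_rough; rewrite /pnat gt0_D //= => /allPn[P].
  by rewrite mem_primes gt0_D //= => /andP[? ?]; rewrite -ltnNge => ?; exists P.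
have P_gt0 := prime_gt0 P_pr.
have le_P1 : P.-1 <= m by rewrite (leq_trans (leq_pred_prime_totient P_pr _ P_dvd)) ?gt0_D ?le_D.
have /dvdnP[k nE] := dvdn_trans P_dvd (dvd_D d dD).
have k_gt0 : 0 < k by move: n_gt0; rewrite nE muln_gt0 => /andP[].
exists k; have size_k : size (small_divisors m k) <= M.
  apply: leq_trans (size_small_divisors m k_gt0) (leq_trans _ le_M).
  by apply: leq_pexp2l => //; apply: Omega_le_dvd; rewrite // nE dvdn_mulr.
have le_kn : k * Q.+1 <= n by rewrite nE leq_mul2l lt_QP orbT.
have [P_dvdk|P_ndvdk] := boolP (P %| k).
  have [b bE] : exists b : M.-tuple bool, \sum_(d <- [:: P]) id d = masked_sum id b m k.
    apply: masked_sum_exists => // e; rewrite inE => /eqP ->.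
    by rewrite mem_small_divisors // P_dvdk totient_prime // le_P1.
  by exists (true, b, b); split=> //=; rewrite -bE big_seq1 nE.
have co_P e : e %| k -> coprime P e.
  by move=> e_dvd; rewrite prime_coprime //; apply: contra P_ndvdk => /dvdn_trans->.
(* Here [P] divides [n] only once: the members of [D] prime to [P] divide [k], and the others are
   [P * e] with [e] dividing [k], of totient [(P - 1) * totient e]. *)
pose A := [seq e <- D | ~~ (P %| e)].
pose B := [seq e %/ P | e <- D & P %| e].
have [b1 b1E] : exists b : M.-tuple bool, \sum_(e <- A) totient e = masked_sum totient b m k.
  apply: masked_sum_exists => //; first by rewrite filter_uniq.
  move=> e; rewrite mem_filter => /andP[P_ndvd eD]; rewrite mem_small_divisors // le_D //=.
  by rewrite -(@Gauss_dvdl _ _ P) -?nE ?dvd_D // coprime_sym prime_coprime.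
have B_dvd e : e \in B -> e %| k.
  move=> /mapP[f]; rewrite mem_filter => /andP[Pf fD] ->.
  by rewrite -(@dvdn_pmul2r P) // divnK // -nE dvd_D.
have sumB : \sum_(e <- D | P %| e) totient e = (\sum_(e <- B) totient e) * P.-1.
  rewrite big_map big_filter big_distrl /= big_seq_cond [RHS]big_seq_cond.
  apply: eq_bigr => e /andP[eD Pe].
  have dvd_k : e %/ P %| k by apply: B_dvd; apply: (map_f (divn^~ P)); rewrite mem_filter Pe.
  by rewrite -{1}(divnK Pe) totient_coprime ?(totient_prime P_pr) // coprime_sym co_P.
have [b2 b2E] : exists b : M.-tuple bool, \sum_(e <- B) totient e = masked_sum totient b m k.
  apply: masked_sum_exists => //.
    rewrite map_inj_in_uniq ?filter_uniq // => e f.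
    rewrite !mem_filter => /andP[Pe _] /andP[Pf _] ef.
    by rewrite -(divnK Pe) ef divnK.
  move=> e eB; rewrite mem_small_divisors // B_dvd // andbT.
  case/mapP: (eB) => f; rewrite mem_filter => /andP[Pf fD] eE.
  rewrite (leq_trans _ (le_D f fD)) // -(divnK Pf) -eE totient_coprime.
    by rewrite leq_pmulr // totient_gt0.
  by rewrite coprime_sym co_P // B_dvd.
(* The member [d] contributes to [B], so the division in [rebuild] has a nonzero divisor and yields
   exactly [P - 1]. *)
have B_gt0 : 0 < \sum_(e <- B) totient e.
  have dB : d %/ P \in B by apply: (map_f (divn^~ P)); rewrite mem_filter P_dvd.
  rewrite (big_rem _ dB) /= ltn_addr // totient_gt0 divn_gt0 //.
  by rewrite dvdn_leq ?gt0_D.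
exists (false, b1, b2); split => //=; rewrite -b1E -b2E.
have -> : m - \sum_(e <- A) totient e = (\sum_(e <- B) totient e) * P.-1.
  by rewrite -sumD (bigID (fun e => P %| e)) /= sumB big_filter addnK.
by rewrite mulKn // prednK.
Qed.

(** As [P > Q], the cofactor [k = n / P] satisfies [k * (Q + 1) <= n <= N], which gives its
    range. *)
Definition rebuilt_exponents m Q M N : seq nat :=
  [seq rebuild m k (t.1.1, val t.1.2, val t.2) | k <- iota 1 (N %/ Q.+1),
     t <- enum {: bool * M.-tuple bool * M.-tuple bool}].

Lemma size_rebuilt_exponents m Q M N :
  size (rebuilt_exponents m Q M N) = (N %/ Q.+1) * (2 * 4 ^ M).
Proof.
rewrite size_allpairs size_iota -cardE !card_prod card_bool card_tuple card_bool.
by rewrite -mulnA -expnMn.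
Qed.

Lemma mem_rebuilt_exponents n m Q M N (D : seq nat) :
    0 < n <= N -> 0 < Q -> subseq D (divisors n) -> \sum_(d <- D) totient d = m ->
    2 ^ Omega_le m.+1 n <= M -> M * Q ^ Omega_le m.+1 n < m ->
  n \in rebuilt_exponents m Q M N.
Proof.
move=> /andP[n_gt0 le_nN] Q_gt0 sub_D sumD le_M lt_m.
have [k [t [k_gt0 le_kn nE]]] := rebuild_exists n_gt0 Q_gt0 sub_D sumD le_M lt_m.
apply/allpairsP; exists (k, t); split=> //=; last by rewrite mem_enum.
by rewrite mem_iota k_gt0 add1n ltnS leq_divRL // (leq_trans le_kn).
Qed.

Local Open Scope ring_scope.

(** * Divisors of [T^n - 1] over the rationals *)

(** The image of ['Phi_n] is the minimal polynomial of a primitive root [z]. If it factors as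
    [r * q], then [z] is a root of one factor, which it therefore divides; a nonconstant [q] makes
    [r] too small for that. *)
Lemma Cyclotomic_irreducible n : (0 < n)%N ->
  irreducible_poly (map_poly intr 'Phi_n : {poly rat}).
Proof.
move=> n_gt0; have [z prim_z] := C_prim_root_exists n_gt0.
set Phi := map_poly intr 'Phi_n.
have [p [minp mon_p] rootp] := minCpolyP z.
have {minp} pE : p = Phi.
  apply: (map_poly_inj (ratr : {rmorphism rat -> algC})).
  rewrite -minp (minCpoly_cyclotomic prim_z) -(Cintr_Cyclotomic prim_z) -map_poly_comp.
  by apply: eq_map_poly => a /=; rewrite ratr_int.
rewrite {}pE in mon_p rootp.
have sizePhi : size Phi = (totient n).+1.
  by rewrite size_map_inj_poly ?size_Cyclotomic //; exact: intr_inj.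
split=> [|q size_q q_dvd]; first by rewrite sizePhi ltnS totient_gt0.
have /dvdpP[r Phi_rq] := q_dvd.
have rq_neq0 : r * q != 0 by rewrite -Phi_rq monic_neq0.
have : root (map_poly ratr Phi) z by rewrite rootp dvdpp.
rewrite Phi_rq rmorphM rootM !rootp => /orP[|Phi_q]; last first.
  by rewrite /eqp -Phi_rq q_dvd.
move: rq_neq0; rewrite mulf_eq0 negb_or => /andP[r_neq0 q_neq0].
move=> /(dvdp_leq r_neq0); rewrite Phi_rq size_mul //.
rewrite -size_poly_gt0 in q_neq0; move: q_neq0 size_q.
by case: (size q) => [//|[//|k]] _ _; rewrite !addnS /= ltnNge leq_addr.
Qed.

Lemma size_dvdp_prod_irreducible (F : fieldType) (I : Type) (q : I -> {poly F})
    (s : seq I) (p : {poly F}) :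
    (forall i, irreducible_poly (q i)) -> p %| \prod_(i <- s) q i ->
  exists b : bitseq, (size p).-1 = (\sum_(i <- mask b s) (size (q i)).-1)%N.
Proof.
move=> irr_q; elim: s p => [|i s IHs] p.
  rewrite big_nil dvdp1 => /eqP ->; exists [::]; by rewrite big_nil.
have irr_i := irr_q i; have qi_neq0 := irredp_neq0 irr_i.
have prod_neq0 : \prod_(j <- s) q j != 0.
  apply: (big_ind (fun r => r != 0)) => [|r1 r2 r1_neq0 r2_neq0|j _].
  - exact: oner_neq0.
  - by rewrite mulf_neq0.
  - exact: irredp_neq0.
rewrite big_cons => p_dvd.
have p_neq0 : p != 0.
  by apply: contraTneq p_dvd => ->; rewrite dvd0p mulf_neq0.
case: (boolP (coprimep p (q i))) => [co_p|].
  rewrite Gauss_dvdpr // in p_dvd.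
  by have [b ->] := IHs _ p_dvd; exists (false :: b).
rewrite /coprimep => /(irr_i.2 _)/(_ (dvdp_gcdr _ _)) gcd_qi.
have /dvdpP[r p_rq] : q i %| p by rewrite -(eqp_dvdl _ gcd_qi) dvdp_gcdl.
rewrite p_rq mulrC dvdp_mul2l // in p_dvd.
have [b size_r] := IHs _ p_dvd; exists (true :: b).
rewrite /= big_cons -size_r p_rq in p_neq0 *.
move: p_neq0; rewrite mulf_eq0 negb_or => /andP[r_neq0 _].
rewrite size_mul // -(prednK (_ : 0 < size r)%N) ?size_poly_gt0 //.
by rewrite -(prednK (_ : 0 < size (q i))%N) ?size_poly_gt0 // !addSn !addnS /= addnC.
Qed.

Lemma Xn_sub_1_divisor_degree n (d : {poly rat}) : (0 < n)%N -> d %| 'X^n - 1 ->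
  exists2 s : seq nat, subseq s (divisors n) &
    (size d).-1 = (\sum_(e <- s) totient e)%N.
Proof.
(* On divisors of [n], [e.-1.+1] is [e]; this form makes the factor irreducible for every index
   [e]. *)
move=> n_gt0; have -> : 'X^n - 1 = \prod_(e <- divisors n)
    map_poly intr 'Phi_(e.-1.+1) :> {poly rat}.
  transitivity (map_poly intr ('X^n - 1 : {poly int}) : {poly rat}).
    by rewrite rmorphB rmorph1 /= map_polyXn.
  rewrite -(prod_Cyclotomic n_gt0) rmorph_prod big_seq [RHS]big_seq.
  by apply: eq_bigr => e; rewrite -dvdn_divisors // => /(dvdn_gt0 n_gt0)/prednK ->.
move=> /size_dvdp_prod_irreducible[|b ->].
  by move=> e; apply: Cyclotomic_irreducible.
exists (mask b (divisors n)); first exact: mask_subseq.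
rewrite big_seq [RHS]big_seq; apply: eq_bigr => e /mem_mask.
rewrite -dvdn_divisors // => /(dvdn_gt0 n_gt0)/prednK ->.
by rewrite size_map_inj_poly ?size_Cyclotomic //; exact: intr_inj.
Qed.

(** * Moments of the number of prime factors *)

Lemma sum_multiples (V : nmodType) (p N : nat) (h : nat -> V) : (0 < p)%N ->
  \sum_(n <- iota 1 N | (p %| n)%N) h n = \sum_(j <- iota 1 (N %/ p)) h (p * j)%N.
Proof.
move=> p_gt0; rewrite -big_filter -(big_map (muln p) predT h).
apply: perm_big; apply: uniq_perm.
- by rewrite filter_uniq // iota_uniq.
- by rewrite map_inj_uniq ?iota_uniq // => i j /eqP; rewrite eqn_pmul2l // => /eqP.
move=> n; rewrite mem_filter mem_iota add1n ltnS; apply/andP/mapP.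
  move=> [/dvdnP[j ->] /andP[n_gt0 n_le]]; exists j; last by rewrite mulnC.
  by rewrite mem_iota add1n ltnS leq_divRL // n_le andbT; case: j n_gt0 {n_le}.
move=> [j]; rewrite mem_iota add1n ltnS leq_divRL // => /andP[j_gt0 j_le] ->.
by rewrite dvdn_mulr // muln_gt0 p_gt0 j_gt0 mulnC.
Qed.

Lemma natr_div_le (R : realFieldType) (N p : nat) :
  ((N %/ p)%:R : R) <= N%:R / p%:R.
Proof.
have [->|p_gt0] := posnP p; first by rewrite divn0 invr0 mulr0.
by rewrite ler_pdivlMr ?ltr0n // -natrM ler_nat leq_divM.
Qed.

(** Only the multiples [p * j] contribute to the excess [w ^ logn p n - 1], and [w ^ (v + 1) - 1 = w
    * (w ^ v - 1) + (w - 1)] expresses the excess up to [N] through the one up to [N / p]. *)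
Lemma sum_expn_logn_step (R : realFieldType) (w : R) (g : nat -> R) (p : nat) (B : R) :
    1 <= w < 2 -> prime p ->
    (forall n, (0 < n)%N -> g (p * n)%N = g n) -> 0 <= B ->
    (forall N, \sum_(n <- iota 1 N) g n <= N%:R * B) ->
  forall N, \sum_(n <- iota 1 N) g n * w ^+ logn p n
    <= N%:R * (B * (1 + (w - 1) / (p%:R - w))).
Proof.
move=> /andP[w_ge1 w_lt2] p_pr g_p B_ge0 le_g; have p_gt0 := prime_gt0 p_pr.
have p_ge2 : 2 <= p%:R :> R by rewrite (ler_nat R 2) prime_gt1.
(* The fixed point of the recursion on the excess; [w < 2 <= p] keeps the denominator positive. *)
set c := (w - 1) / (p%:R - w).
have c_ge0 : 0 <= c by rewrite divr_ge0 //; lra.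
have cE : w * c + (w - 1) = c * p%:R by rewrite /c; field; lra.
have excess N : \sum_(n <- iota 1 N) g n * (w ^+ logn p n - 1) <= N%:R * (B * c).
  elim/ltn_ind: N => N IHN.
  have [->|N_gt0] := posnP N; first by rewrite big_nil mul0r.
  rewrite (bigID (fun n => (p %| n)%N)) /= [X in _ + X]big1 ?addr0; last first.
    move=> n /negbTE p_ndvd; rewrite lognE p_ndvd !andbF expr0 subrr mulr0 //.
  rewrite sum_multiples // big_seq.
  have -> : \sum_(j <- iota 1 (N %/ p) | j \in iota 1 (N %/ p))
      g (p * j)%N * (w ^+ logn p (p * j) - 1) =
      w * (\sum_(j <- iota 1 (N %/ p)) g j * (w ^+ logn p j - 1)) +
      (w - 1) * \sum_(j <- iota 1 (N %/ p)) g j.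
    rewrite !big_distrr /= -big_split /= [RHS]big_seq.
    apply: eq_bigr => j; rewrite mem_iota => /andP[j_gt0 _].
    rewrite g_p // lognM // logn_prime // eqxx exprS; ring.
  have /IHN le_D : (N %/ p < N)%N by rewrite ltn_Pdiv ?prime_gt1.
  have le_G := le_g (N %/ p)%N.
  apply: (@le_trans _ _ ((N %/ p)%:R * (B * (w * c + (w - 1))))); first by nra.
  have -> : (N %/ p)%:R * (B * (w * c + (w - 1))) = (N %/ p)%:R * p%:R * (B * c).
    by rewrite cE; ring.
  apply: ler_wpM2r; first exact: mulr_ge0.
  by rewrite -ler_pdivlMr ?ltr0n // natr_div_le.
move=> N; rewrite mulrDr mulrDr mulr1.
apply: le_trans (lerD (le_g N) (excess N)).
by rewrite -big_split /=; apply: ler_sum => n _; lra.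
Qed.

(** Primes are added one at a time: multiplying [n] by [p] does not change the weight coming from
    the other primes. *)
Lemma sum_expn_prod_logn (R : realFieldType) (w : R) (ps : seq nat) N :
    1 <= w < 2 -> uniq ps -> all prime ps ->
  \sum_(n <- iota 1 N) w ^+ (\sum_(p <- ps) logn p n)
    <= N%:R * \prod_(p <- ps) (1 + (w - 1) / (p%:R - w)).
Proof.
move=> w_bd uniq_ps all_ps; have : forall p : nat, prime p -> 0 <= (w - 1) / (p%:R - w).
  move=> p p_pr; have : 2 <= p%:R :> R by rewrite (ler_nat R 2) prime_gt1.
  by move=> ?; case/andP: w_bd => ? ?; rewrite divr_ge0 //; lra.
move=> term_ge0; elim: ps N uniq_ps all_ps => [|p ps IHps] N.
  move=> _ _; rewrite big_nil mulr1.
  under eq_bigr do rewrite big_nil expr0.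
  by rewrite big_const_seq count_predT size_iota iter_addr_0.
move=> /= /andP[p_ps uniq_ps] /andP[p_pr all_ps]; rewrite big_cons [_ * \prod_(_ <- _) _]mulrC.
under eq_bigr do rewrite big_cons addnC exprD.
apply: sum_expn_logn_step => // [n n_gt0|  |N'].
- congr (_ ^+ _); rewrite big_seq [RHS]big_seq; apply: eq_bigr => q q_ps.
  have q_pr := allP all_ps q q_ps.
  rewrite (lognM _ (prime_gt0 p_pr) n_gt0) logn_prime //; case: eqP p_ps => [<-|//].
  by rewrite q_ps.
- rewrite big_seq prodr_ge0 // => q /(allP all_ps)/term_ge0; lra.
- exact: IHps.
Qed.

Lemma sum_expn_Omega_le (R : realFieldType) (w : R) y N : 1 <= w < 2 ->
  \sum_(n <- iota 1 N) w ^+ Omega_le y n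
    <= N%:R * \prod_(p <- iota 0 y.+1 | prime p) (1 + (w - 1) / (p%:R - w)).
Proof.
move=> w_bd; rewrite -big_filter.
apply: le_trans (sum_expn_prod_logn N w_bd _ _).
- apply: ler_sum => n _.
  rewrite big_filter /Omega_le -(big_mkord xpredT (fun p => logn p n)) /index_iota.
  rewrite subn0 [X in _ <= _ ^+ X]big_mkcond /= le_eqVlt; apply/orP; left.
  apply/eqP; congr (_ ^+ _).
  by apply: eq_bigr => p _; rewrite /logn; case: (prime p).
- by rewrite filter_uniq // iota_uniq.
- exact: filter_all.
Qed.

(** * The Euler product and the zeta series at [1 + a] *)

Definition zeta_term (R : realType) (a : R) (n : nat) : R :=
  expR (- ((1 + a) * ln n%:R)).

Lemma zeta_termM (R : realType) (a : R) m n : (0 < m)%N -> (0 < n)%N ->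
  zeta_term a (m * n) = zeta_term a m * zeta_term a n.
Proof.
move=> m_gt0 n_gt0; rewrite /zeta_term -expRD natrM lnM ?posrE ?ltr0n //.
by congr expR; ring.
Qed.

Lemma zeta_term_gt0 (R : realType) (a : R) n : 0 < zeta_term a n.
Proof. exact: expR_gt0. Qed.

Lemma zeta_termE (R : realType) (a : R) n : (0 < n)%N ->
  zeta_term a n = n%:R^-1 * expR (- (a * ln n%:R)).
Proof.
move=> n_gt0; have {1}-> : n%:R = expR (ln n%:R) :> R by rewrite lnK ?posrE ?ltr0n.
by rewrite -expRN -expRD; congr expR; ring.
Qed.

(* [a * (k + 1) ^ (- 1 - a) <= k ^ (- a) - (k + 1) ^ (- a)]: the telescoping
   majorant of the tail of the zeta series. *)
Lemma expRN_ln_decrement (R : realType) (a k : R) : 0 < a -> 0 < k ->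
  (k + 1)^-1 * expR (- (a * ln (k + 1)))
    <= a^-1 * (expR (- (a * ln k)) - expR (- (a * ln (k + 1)))).
Proof.
move=> a_gt0 k_gt0; have M_gt0 : 0 < k + 1 by lra.
have l_ge : (k + 1)^-1 <= ln (k + 1) - ln k.
  have := expR_ge1Dx (- (ln (k + 1) - ln k)).
  rewrite opprB expRB !lnK ?posrE // => le_l.
  have -> : (k + 1)^-1 = 1 - k / (k + 1) by field; lra.
  lra.
have -> : - (a * ln k) = - (a * ln (k + 1)) + a * (ln (k + 1) - ln k) by ring.
rewrite expRD.
have e_gt0 := expR_gt0 (- (a * ln (k + 1))); set e := expR _ in e_gt0 *.
have le_f := expR_ge1Dx (a * (ln (k + 1) - ln k)); set f := expR _ in le_f *.
have -> : a^-1 * (e * f - e) = (f - 1) / a * e by ring.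
apply: ler_wpM2r; first exact: ltW.
rewrite ler_pdivlMr // mulrC.
apply: le_trans (ler_wpM2l (ltW a_gt0) l_ge) _; lra.
Qed.

Lemma sum_zeta_term (R : realType) (a : R) N : 0 < a ->
  \sum_(n <- iota 1 N) zeta_term a n <= 1 + a^-1.
Proof.
move=> a_gt0; have ia_gt0 : 0 < a^-1 by rewrite invr_gt0.
case: N => [|N]; first by rewrite big_nil; lra.
(* Keeping the telescoping term [(N + 1) ^ (- a)] lets the induction go through. *)
suff : \sum_(n <- iota 1 N.+1) zeta_term a n
    <= 1 + a^-1 * (1 - expR (- (a * ln N.+1%:R))).
  move/le_trans; apply; have := expR_gt0 (- (a * ln (N.+1%:R : R))); nra.
elim: N => [|N IHN].
  by rewrite big_seq1 zeta_termE // ln1 mulr0 oppr0 expR0; lra.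
rewrite -[N.+2]addn1 iotaD big_cat big_seq1 /= addn1 add1n zeta_termE //.
have := expRN_ln_decrement a_gt0 (ltr0Sn R N); rewrite natr1.
set e1 := expR _ in IHN *; set e2 := expR _; move: IHN.
set z := _ * e2; set t := \sum_(n <- _) _; lra.
Qed.

(** Expanding the product gives one term for each squarefree [d] built from [ps]. The condition on
    the prime factors keeps the [d] and the [p * d] disjoint when [p] is added. *)
Lemma prod_1D_zeta_term_sum (R : realType) (a : R) (ps : seq nat) :
    uniq ps -> all prime ps ->
  exists s : seq nat, [/\ uniq s,
    forall d, d \in s -> (0 < d)%N /\ forall p, prime p -> (p %| d)%N -> p \in ps &
    \prod_(p <- ps) (1 + zeta_term a p) = \sum_(d <- s) zeta_term a d].
Proof.
elim: ps => [|p ps IHps].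
  exists [:: 1%N]; split=> //.
    move=> d; rewrite inE => /eqP ->; split=> // p p_pr; rewrite dvdn1 => /eqP p1.
    by rewrite p1 in p_pr.
  by rewrite big_nil big_seq1 /zeta_term ln1 mulr0 oppr0 expR0.
move=> /= /andP[p_ps uniq_ps] /andP[p_pr all_ps].
have p_gt0 := prime_gt0 p_pr.
have [s [uniq_s supp_s prodE]] := IHps uniq_ps all_ps.
exists (s ++ map (muln p) s); split.
- rewrite cat_uniq uniq_s map_inj_uniq ?uniq_s ?andbT /=; last first.
    by move=> i j /eqP; rewrite eqn_pmul2l // => /eqP.
  apply/hasPn => _ /mapP[d _ ->]; apply/negP => /supp_s[_ /(_ p p_pr)].
  by rewrite dvdn_mulr // => /(_ isT) p_in; rewrite p_in in p_ps.
- move=> d; rewrite mem_cat => /orP[/supp_s[d_gt0 supp_d]|/mapP[e /supp_s[e_gt0 supp_e] ->]].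
    by split=> // q q_pr /(supp_d q q_pr) q_ps; rewrite inE q_ps orbT.
  split=> [|q q_pr]; first by rewrite muln_gt0 p_gt0.
  rewrite Euclid_dvdM // dvdn_prime2 // inE => /orP[->//|/(supp_e q q_pr) ->].
  by rewrite orbT.
rewrite big_cons prodE big_cat /= mulrDl mul1r; congr (_ + _).
rewrite big_map big_distrr /= big_seq [RHS]big_seq.
by apply: eq_bigr => d /supp_s[d_gt0 _]; rewrite zeta_termM.
Qed.

(** The expanded product is a sum over distinct positive integers, hence at most a partial sum of
    the zeta series. *)
Lemma prod_1D_zeta_term (R : realType) (a : R) (ps : seq nat) : 0 < a ->
  uniq ps -> all prime ps -> \prod_(p <- ps) (1 + zeta_term a p) <= 1 + a^-1.
Proof.
move=> a_gt0 uniq_ps all_ps.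
have [s [uniq_s supp_s ->]] := prod_1D_zeta_term_sum a uniq_ps all_ps.
apply: le_trans (sum_zeta_term (\max_(d <- s) d) a_gt0).
set N := (\max_(d <- s) d)%N.
have -> : \sum_(d <- s) zeta_term a d
    = \sum_(d <- iota 1 N | d \in s) zeta_term a d.
  rewrite -[RHS]big_filter; apply: perm_big; apply: uniq_perm => //.
    by rewrite filter_uniq // iota_uniq.
  move=> d; rewrite mem_filter mem_iota add1n ltnS.
  have [ds|//] := boolP (d \in s); have [-> _] := supp_s d ds.
  by rewrite leq_bigmax_seq.
by rewrite big_mkcond; apply: ler_sum => d _; case: ifP => // _; apply/ltW/zeta_term_gt0.
Qed.

(** This is the zeta bound at [a = 1]. *)
Lemma sum_inv_sqr (R : realType) (y : nat) :
  \sum_(n <- iota 1 y) (n%:R^-1 ^+ 2 : R) <= 2.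
Proof.
have -> : 2 = 1 + 1^-1 :> R by lra.
apply: le_trans (sum_zeta_term y ltr01); rewrite big_seq [leRHS]big_seq.
apply: ler_sum => n; rewrite mem_iota => /andP[n_gt0 _].
by rewrite zeta_termE // mul1r expRN lnK ?posrE ?ltr0n.
Qed.

(** From [1 - u + u ^ 2 <= expR (- (u - u ^ 2))] and [(1 + u) * (1 - u + u ^ 2) = 1 + u ^ 3 >=
    1]. *)
Lemma subr_sqr_le_ln1D (R : realType) (u : R) : 0 <= u -> u - u ^+ 2 <= ln (1 + u).
Proof.
move=> u_ge0; have u1_gt0 : 0 < 1 + u by lra.
rewrite -ler_expR lnK ?posrE //.
have := expR_ge1Dx (- (u - u ^+ 2)); rewrite expRN.
have e_gt0 := expR_gt0 (u - u ^+ 2); set e := expR _ in e_gt0 *.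
rewrite -(ler_pM2r e_gt0) mulVf ?gt_eqF // => le_e.
have : 0 <= u ^+ 3 by rewrite exprn_ge0.
rewrite exprS => u3_ge0.
nra.
Qed.

(** Rankin's trick: [P ^ a <= expR e] gives [P ^ (- 1) <= expR e * u] with [u = P ^ (- 1 - a)], and
    [u] is [ln (1 + u)] up to a term of order [P ^ (- 2)]. *)
Lemma moment_factor_le (R : realType) (w e a P : R) : 1 <= w < 2 -> 2 <= P ->
    0 <= a * ln P <= e ->
  1 + (w - 1) / (P - w) <= expR ((w - 1) *
    (expR e * ln (1 + P^-1 * expR (- (a * ln P)))
      + (expR e + 2 * w / (2 - w)) * P^-1 ^+ 2)).
Proof.
move=> /andP[w_ge1 w_lt2] P_ge2 /andP[aP_ge0 aP_le].
apply: le_trans (expR_ge1Dx _) _; rewrite ler_expR.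
apply: ler_wpM2l; first lra.
have iP_gt0 : 0 < P^-1 by rewrite invr_gt0; lra.
have P_ge0 : 0 < P by lra.
set u := P^-1 * _; have u_ge0 : 0 <= u by rewrite mulr_ge0 ?expR_ge0 // ltW.
have u_le : u <= P^-1 by apply: ler_piMr; [exact: ltW|rewrite expR_le1; lra].
have iP_le : P^-1 <= expR e * u.
  rewrite /u mulrCA -expRD; apply: ler_peMr; first exact: ltW.
  by apply: le_trans (expR_ge1Dx _); lra.
have le_ln := subr_sqr_le_ln1D u_ge0.
have u2_le : u ^+ 2 <= P^-1 ^+ 2 by rewrite lerXn2r ?nnegrE // ltW.
have le1 : P^-1 <= expR e * (ln (1 + u) + P^-1 ^+ 2).
  apply: le_trans iP_le _; apply: ler_wpM2l; [exact: expR_ge0|lra].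
(* The difference of the inverses is [w / (P * (P - w))], and [P - w >= P * (2 - w) / 2] because
   [P >= 2]. *)
have le2 : (P - w)^-1 <= P^-1 + 2 * w / (2 - w) * P^-1 ^+ 2.
  have -> : P^-1 + 2 * w / (2 - w) * P^-1 ^+ 2
      = (P - w)^-1 + w ^+ 2 * (P - 2) / ((P - w) * (2 - w) * P ^+ 2).
    by field; apply/and3P; split; lra.
  rewrite lerDl divr_ge0 //.
    by rewrite mulr_ge0 ?sqr_ge0 //; lra.
  by rewrite !mulr_ge0 ?sqr_ge0 //; lra.
lra.
Qed.

Lemma prod_moment_factor_le (R : realType) (w e : R) : 1 <= w < 2 -> 0 < e ->
  exists B : R, forall y, (1 < y)%N ->
    \prod_(p <- iota 0 y.+1 | prime p) (1 + (w - 1) / (p%:R - w))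
      <= expR ((w - 1) * (expR e * ln (1 + ln y%:R / e) + B)).
Proof.
move=> w_bd e_gt0; exists ((expR e + 2 * w / (2 - w)) * 2) => y y_gt1.
case/andP: (w_bd) => w_ge1 w_lt2.
have lny_gt0 : 0 < ln (y%:R : R) by rewrite ln_gt0 // (ltr_nat R 1).
(* The largest [a] with [a * ln p <= e] for all [p <= y]. *)
pose a := e / ln (y%:R : R); have a_gt0 : 0 < a by rewrite divr_gt0.
have -> : ln y%:R / e = a^-1 :> R by rewrite invf_div.
have prime_ge2 p : prime p -> 2 <= p%:R :> R by move=> ?; rewrite (ler_nat R 2) prime_gt1.
rewrite big_seq_cond.
apply: (@le_trans _ _ (\prod_(p <- iota 0 y.+1 | (p \in iota 0 y.+1) && prime p)
    expR ((w - 1) * (expR e * ln (1 + zeta_term a p)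
      + (expR e + 2 * w / (2 - w)) * p%:R^-1 ^+ 2)))).
  apply: ler_prod => p /andP[]; rewrite mem_iota add0n ltnS => /= p_le p_pr.
  have P_ge2 := prime_ge2 p p_pr.
  apply/andP; split.
    by rewrite addr_ge0 // divr_ge0 //; lra.
  rewrite zeta_termE ?prime_gt0 //; apply: moment_factor_le => //.
  apply/andP; split.
    by apply: mulr_ge0; [exact: ltW|apply: ln_ge0; lra].
  rewrite /a mulrAC ler_pdivrMr //; apply: ler_wpM2l; first exact: ltW.
  by rewrite ler_ln ?posrE ?ltr0n ?ler_nat ?(prime_gt0 p_pr) // (ltnW y_gt1).
rewrite -big_seq_cond -expR_sum ler_expR -big_distrr /=.
apply: ler_wpM2l; first lra.
rewrite big_split /= -!big_distrr /=; apply: lerD.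
  apply: ler_wpM2l; first exact: expR_ge0.
  rewrite -ler_expR expR_sum lnK ?posrE ?addr_gt0 ?invr_gt0 //.
  have uniq_ps : uniq [seq p <- iota 0 y.+1 | prime p] by rewrite filter_uniq // iota_uniq.
  apply: le_trans (prod_1D_zeta_term a_gt0 uniq_ps (filter_all _ _)).
  rewrite big_filter le_eqVlt; apply/orP; left; apply/eqP; apply: eq_bigr => p _.
  by rewrite lnK // posrE addr_gt0 // zeta_term_gt0.
apply: ler_wpM2l; first by rewrite addr_ge0 ?expR_ge0 // divr_ge0 //; lra.
apply: le_trans (sum_inv_sqr R y).
rewrite /= big_cons /=; rewrite big_mkcond; apply: ler_sum => p _.
by case: ifP => // _; rewrite sqr_ge0.
Qed.

(** * Parameters and counting *)

(** This puts [w = 1 / ln 2] in the range of the moment bound. *)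
Lemma ln2_bounds (R : realType) : 2^-1 < ln (2 : R) < 1.
Proof.
apply/andP; split.
  rewrite -ltr_expR lnK ?posrE //.
  have := @expR_gt1Dx R (- 2^-1); rewrite oppr_eq0 invr_eq0 pnatr_eq0 => /(_ isT).
  rewrite expRN -(@ltr_pM2r _ (expR 2^-1)) ?expR_gt0 // mulVf ?gt_eqF ?expR_gt0 //.
  lra.
rewrite -ltr_expR lnK ?posrE //.
have := @expR_gt1Dx R 1; rewrite oner_eq0 => /(_ isT); lra.
Qed.

Lemma deltaE (R : realType) (w : R) : w = (ln 2)^-1 -> delta R = 1 - w + w * ln w.
Proof.
case/andP: (ln2_bounds R) => ln2_gt _ ->.
by rewrite /delta lnV ?posrE; [ring|lra].
Qed.

Lemma parameter_choice (R : realType) (w delta' : R) : w = (ln 2)^-1 ->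
    0 < delta' -> delta' < delta R ->
  exists t : R, 0 < t < 1 /\
    (w - 1) * (1 + t) + delta' <= w * (1 - t) * ln w.
Proof.
move=> wE d_gt0; rewrite (deltaE wE) => d_lt.
case/andP: (ln2_bounds R) => ln2_gt ln2_lt.
have w_gt1 : 1 < w by rewrite wE invf_gt1 //; lra.
have lnw_gt0 : 0 < ln w by rewrite ln_gt0.
(* The goal reads [t * G <= eta]; adding [eta] to the denominator of [eta / G] also keeps
   [t < 1]. *)
pose G := w * ln w + w - 1; pose eta := 1 - w + w * ln w - delta'.
have G_gt0 : 0 < G by rewrite /G; nra.
have eta_gt0 : 0 < eta by rewrite /eta; lra.
have Ge_gt0 : 0 < G + eta by lra.
exists (eta / (G + eta)); rewrite divr_gt0 //= ltr_pdivrMr // mul1r; split; first lra.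
have : eta / (G + eta) * G <= eta.
  by rewrite mulrAC ler_pdivrMr // ler_wpM2l //; lra.
by rewrite /G /eta; set t := _ / _; nra.
Qed.

Lemma expR_ge1D_sqr (R : realType) (x : R) : 0 <= x -> 1 + x ^+ 2 / 2 <= expR x.
Proof. by move=> x_ge0; have := expR_ge1Dxn 1 x_ge0. Qed.

(** Used with [l = ln ln m]. On taking logarithms, the first inequality says that [(ln m) ^ (1 - t)]
    numbers of size [Q ^ (k * l)] add up to less than [m]; the second, that [Q] outweighs the number
    of pairs of masks by a factor [(ln m) ^ d]. *)
Lemma exponential_domination (R : realType) (t k d : R) : 0 < t < 1 -> 0 <= k -> 0 <= d ->
  exists l0 : R, 0 <= l0 /\ forall l, l0 <= l ->
    (1 - t) * l + k * l * expR ((1 - t / 2) * l) < expR l /\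
    2 * expR ((1 - t) * l) + d * l <= expR ((1 - t / 2) * l).
Proof.
move=> /andP[t_gt0 t_lt1] k_ge0 d_ge0.
have t2_gt0 : 0 < t ^+ 2 by rewrite exprn_gt0.
have q_ge0 : 0 <= 8 * (1 + k) / t ^+ 2 by rewrite divr_ge0 ?ltW //; lra.
(* Each summand serves one use of [1 + x ^ 2 / 2 <= expR x]: the last gives [(1 + k) * l < U], then
   [4] gives [4 <= U], and [16 * d] gives [d * l <= V / 2]. *)
exists (4 + 16 * d + 8 * (1 + k) / t ^+ 2); split; first lra.
move=> l l_ge; have l_ge4 : 4 <= l by lra.
have l_ge0 : 0 <= l by lra.
have lq : 8 * (1 + k) <= l * t ^+ 2 by rewrite -ler_pdivrMr //; lra.
have ld : 16 * d <= l by lra.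
set U := expR (t / 2 * l); set V := expR ((1 - t / 2) * l).
have -> : expR l = U * V by rewrite -expRD; congr expR; field.
have VE : V = expR ((1 - t) * l) * U by rewrite -expRD; congr expR; field.
have U_gt : (1 + k) * l < U.
  have x_ge0 : 0 <= t / 2 * l by rewrite mulr_ge0 // divr_ge0 // ltW.
  have := expR_ge1D_sqr x_ge0; rewrite -/U.
  have -> : (t / 2 * l) ^+ 2 / 2 = l * t ^+ 2 * l / 8 by field.
  nra.
have V_ge : 1 + l ^+ 2 / 8 <= V.
  apply: (@le_trans _ _ (expR (l / 2))); last by rewrite ler_expR; nra.
  have x_ge0 : 0 <= l / 2 by rewrite divr_ge0.
  have := expR_ge1D_sqr x_ge0.
  by have -> : (l / 2) ^+ 2 / 2 = l ^+ 2 / 8 by field.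
have U_ge4 : 4 <= U by nra.
have E_gt0 := expR_gt0 ((1 - t) * l); set E := expR _ in VE E_gt0 *.
have V_gt0 : 0 < V by exact: expR_gt0.
have V_ge1 : 1 <= V by nra.
have l2 : 0 <= l ^+ 2 by rewrite sqr_ge0.
split.
  apply: (@le_lt_trans _ _ ((1 + k) * l * V)); last by rewrite ltr_pM2r.
  have : (1 - t) * l <= l * V by nra.
  lra.
have : 4 * E <= V by rewrite VE; nra.
have : 16 * (d * l) <= l ^+ 2 by rewrite expr2; nra.
lra.
Qed.

Lemma num_good_exponents_le (R : realType) (x : R) m (s : seq nat) :
    (forall n, (0 < n)%N -> n%:R <= x -> has_divisor_of_degree n m -> n \in s) ->
  (num_good_exponents x m <= size s)%N.
Proof.
move=> sub_s; rewrite /num_good_exponents uniq_leq_size ?fset_uniq // => n.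
rewrite in_fset_set; last exact: good_exponents_finite.
by rewrite inE => -[]; apply: sub_s.
Qed.

(** Markov's inequality: [w ^ Omega_le y n] is at least [w ^ v] for every [n] counted. *)
Lemma size_large_Omega_le (R : realType) (w v : R) y N : 1 <= w < 2 ->
  (size [seq n <- iota 1 N | (v < (Omega_le y n)%:R)])%:R <=
    expR (- (v * ln w)) *
    (N%:R * \prod_(p <- iota 0 y.+1 | prime p) (1 + (w - 1) / (p%:R - w))).
Proof.
move=> w_bd; case/andP: (w_bd) => w_ge1 w_lt2.
have lnw_ge0 : 0 <= ln w by rewrite ln_ge0.
rewrite -[X in X <= _]mulr1 mulr_natl -[size _]count_predT.
rewrite -iter_addr_0 -big_const_seq big_filter.
apply: le_trans (ler_wpM2l (expR_ge0 _) (sum_expn_Omega_le y N w_bd)).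
rewrite big_distrr /= big_mkcond; apply: ler_sum => n _.
have -> : w ^+ Omega_le y n = expR ((Omega_le y n)%:R * ln w).
  by rewrite expRM_natl lnK // posrE; lra.
rewrite -expRD; case: ifP => [lt_v|_]; last exact: expR_ge0.
by apply: le_trans (expR_ge1Dx _); nra.
Qed.

(** This returns from the cutoff [m + 1] to [ln ln m]: [m + 1 <= m ^ 2], and [1 <= ln m] absorbs the
    summand [1]. *)
Lemma ln_ln_succ_le (R : realType) (e : R) (m : nat) : 0 < e -> (2 <= m)%N ->
    1 <= ln (m%:R : R) ->
  ln (1 + ln m.+1%:R / e) <= ln (ln m%:R) + ln (1 + 2 / e).
Proof.
move=> e_gt0 m_ge2; set L : R := ln m%:R => L_ge1.
have ie_gt0 : 0 < e^-1 by rewrite invr_gt0.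
have m_gt0 : 0 < m%:R :> R by rewrite ltr0n; case: (m) m_ge2.
have lnS_le : ln (m.+1%:R : R) <= 2 * L.
  have -> : 2 * L = ln (m%:R ^+ 2) by rewrite lnXn // mulr_natl.
  have m_ge2R : 2 <= m%:R :> R by rewrite (ler_nat R 2).
  by rewrite ler_ln ?posrE ?exprn_gt0 // -natr1; nra.
have lnS_ge0 : 0 <= ln (m.+1%:R : R) by rewrite ln_ge0 // ler1n.
rewrite -lnM ?posrE; [|lra|by rewrite addr_gt0 // divr_gt0].
rewrite ler_ln ?posrE; first by nra.
  by rewrite ltr_pwDl // mulr_ge0 // ltW.
by rewrite mulr_gt0 //; [lra|rewrite addr_gt0 // divr_gt0].
Qed.

(** The [2 * 4 ^ M] triples cost at most [2 * expR (2 * M)], as [ln 4 <= 2]; the cofactors save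
    [Q + 1]. *)
Lemma size_rebuilt_exponents_le (R : realType) (x l t d : R) m Q M N :
    N%:R <= x -> M%:R <= expR ((1 - t) * l) ->
    expR (expR ((1 - t / 2) * l)) <= Q.+1%:R ->
    2 * expR ((1 - t) * l) + d * l <= expR ((1 - t / 2) * l) ->
  (size (rebuilt_exponents m Q M N))%:R <= x * (2 * expR (- (d * l))).
Proof.
move=> N_le M_le Q_ge dom; case/andP: (ln2_bounds R) => ln2_gt ln2_lt.
rewrite size_rebuilt_exponents natrM; set V := expR ((1 - t / 2) * l) in dom Q_ge.
have x_ge0 : 0 <= x by apply: le_trans N_le; rewrite ler0n.
have le1 : (N %/ Q.+1)%:R <= x * expR (- V).
  apply: le_trans (natr_div_le _ _ _) _; rewrite expRN.
  apply: ler_pM; rewrite ?invr_ge0 ?ler0n //.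
  by rewrite lef_pV2 // posrE ?expR_gt0 // ltr0n.
have le2 : (2 * 4 ^ M)%:R <= 2 * expR (2 * expR ((1 - t) * l)).
  rewrite natrM natrX; apply: ler_wpM2l => //.
  have -> : 4 = expR (2 * ln 2) :> R.
    by rewrite expRM_natl lnK ?posrE // -natrX.
  rewrite -expRM_natl ler_expR.
  apply: (@le_trans _ _ (M%:R * 2)); last by rewrite mulrC ler_wpM2l.
  by apply: ler_wpM2l; [exact: ler0n|lra].
apply: le_trans (ler_pM (ler0n _ _) (ler0n _ _) le1 le2) _.
rewrite -mulrA; apply: ler_wpM2l => //.
rewrite mulrCA -expRD; apply: ler_wpM2l => //.
rewrite ler_expR; lra.
Qed.

(** The relation [k * ln 2 = 1 - t] turns the bound on [Omega_le] into [2 ^ Omega_le m.+1 n <= expR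
    ((1 - t) * l)]; the left side is an integer, so truncating to [M] loses nothing. *)
Lemma good_exponent_cases (R : realType) (l t k : R) n m Q M N :
    (0 < n <= N)%N -> has_divisor_of_degree n m ->
    m%:R = expR (expR l) -> k * ln 2 = 1 - t -> 0 <= l ->
    M = Num.truncn (expR ((1 - t) * l)) ->
    Q = Num.truncn (expR (expR ((1 - t / 2) * l))) ->
    (1 - t) * l + k * l * expR ((1 - t / 2) * l) < expR l ->
    (Omega_le m.+1 n)%:R <= k * l ->
  n \in rebuilt_exponents m Q M N.
Proof.
move=> n_bd [p [size_p p_dvd]] mE kE l_ge0 ME QE dom Om_le.
case/andP: (n_bd) => n_gt0 _.
have [D sub_D] := Xn_sub_1_divisor_degree n_gt0 p_dvd.
rewrite size_p /= => /esym sumD.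
have V_gt0 := expR_gt0 ((1 - t / 2) * l); set V := expR ((1 - t / 2) * l) in V_gt0 QE dom.
have M_le : M%:R <= expR ((1 - t) * l) by rewrite ME truncn_le ?expR_ge0.
have Q_le : Q%:R <= expR V by rewrite QE truncn_le ?expR_ge0.
apply: (mem_rebuilt_exponents n_bd _ sub_D sumD).
- rewrite QE truncn_ge_nat ?expR_ge0 //.
  by apply: le_trans (expR_ge1Dx _); lra.
- rewrite ME truncn_ge_nat ?expR_ge0 // natrX.
  have -> : 2 = expR (ln 2) :> R by rewrite lnK // posrE.
  case/andP: (ln2_bounds R) => ln2_gt _.
  by rewrite -expRM_natl ler_expR -kE; nra.
rewrite -(ltr_nat R) natrM natrX mE.
apply: (@le_lt_trans _ _ (expR ((1 - t) * l) * expR ((Omega_le m.+1 n)%:R * V))).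
  apply: ler_pM => //; first by rewrite exprn_ge0.
  by rewrite expRM_natl lerXn2r ?nnegrE ?expR_ge0.
rewrite -expRD ltr_expR; apply: le_lt_trans dom.
by rewrite lerD2l ler_wpM2r // ltW.
Qed.

Theorem theorem1p2 (R : realType) (delta' : R)
    (delta'_gt0 : 0 < delta') (delta'_lt : delta' < delta R) :
  exists C : R, 0 < C /\
    forall (x : R) (m : nat), (3 <= m)%N -> m%:R <= x ->
      (num_good_exponents x m)%:R <= C * (x / powR (ln m%:R) delta').
Proof.
case/andP: (ln2_bounds R) => ln2_gt ln2_lt.
pose w : R := (ln 2)^-1.
have ln2_gt0 : 0 < ln (2 : R) by lra.
have w_bd : 1 < w < 2.
  apply/andP; split; first by rewrite /w invf_gt1.
  by rewrite /w -[X in _ < X]invrK ltf_pV2 ?posrE ?invr_gt0.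
case/andP: (w_bd) => w_gt1 w_lt2.
have w_bd' : 1 <= w < 2 by rewrite ltW.
have [t [t_bd t_le]] := @parameter_choice R w _ erefl delta'_gt0 delta'_lt.
case/andP: (t_bd) => t_gt0 t_lt1.
(* Rankin's trick then costs exactly the factor [1 + t] in the exponent. *)
pose e := ln (1 + t); have e_gt0 : 0 < e by rewrite ln_gt0 //; lra.
have eE : expR e = 1 + t by rewrite lnK // posrE; lra.
pose k := w * (1 - t); have k_ge0 : 0 <= k by rewrite mulr_ge0 //; lra.
have kE : k * ln 2 = 1 - t by rewrite /k /w; field; lra.
have [B prod_le] := prod_moment_factor_le w_bd' e_gt0.
have [l0 [l0_ge0 dom]] := exponential_domination t_bd k_ge0 (ltW delta'_gt0).
pose B' := (w - 1) * ((1 + t) * ln (1 + 2 / e) + B).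
(* The three terms pay for the [n] with many prime factors, for the rebuilt [n], and for the range
   [ln ln m < l0], where the trivial bound [x] is used. *)
exists (expR B' + 2 + expR (delta' * l0)); split.
  by rewrite !addr_gt0 // expR_gt0.
move=> x m m_ge3 m_le_x.
have m_gt0 : 0 < m%:R :> R by rewrite ltr0n (leq_trans _ m_ge3).
have x_ge0 : 0 <= x by lra.
have lnm_gt0 : 0 < ln (m%:R : R) by rewrite ln_gt0 // (ltr_nat R 1) (leq_trans _ m_ge3).
pose l := ln (ln (m%:R : R)).
have -> : powR (ln m%:R) delta' = expR (delta' * l) by rewrite /powR gt_eqF.
rewrite -expRN.
pose N := Num.truncn x.
have N_le : N%:R <= x by rewrite truncn_le.
have le_N n : n%:R <= x -> (n <= N)%N by rewrite truncn_ge_nat.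
have el_gt0 := expR_gt0 (- (delta' * l)).
have xel_ge0 : 0 <= x * expR (- (delta' * l)) by rewrite mulr_ge0 // ltW.
have eB_gt0 := expR_gt0 B'; have el0_gt0 := expR_gt0 (delta' * l0).
have [lt_l|le_l] := ltP l l0.
  apply: (@le_trans _ _ x).
    apply: le_trans N_le; rewrite ler_nat -[N](size_iota 1).
    apply: num_good_exponents_le => n n_gt0 /le_N n_le _.
    by rewrite mem_iota n_gt0 add1n ltnS.
  have le1 : 1 <= expR (delta' * l0) * expR (- (delta' * l)).
    by rewrite -expRD; apply: le_trans (expR_ge1Dx _); nra.
  apply: (@le_trans _ _ (expR (delta' * l0) * (x * expR (- (delta' * l))))).
    by rewrite mulrCA ler_peMr.
  by apply: ler_wpM2r => //; lra.
have l_ge0 : 0 <= l by lra.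
have lnmE : ln (m%:R : R) = expR l by rewrite /l lnK.
have mE : m%:R = expR (expR l) by rewrite -lnmE lnK.
have lnm_ge1 : 1 <= ln (m%:R : R).
  by rewrite lnmE; apply: le_trans (expR_ge1Dx _); lra.
have [dom1 dom2] := dom l le_l.
pose M := Num.truncn (expR ((1 - t) * l)).
pose Q := Num.truncn (expR (expR ((1 - t / 2) * l))).
pose s1 := [seq n <- iota 1 N | k * l < (Omega_le m.+1 n)%:R].
pose s2 := rebuilt_exponents m Q M N.
have num_le : (num_good_exponents x m <= size s1 + size s2)%N.
  rewrite -size_cat; apply: num_good_exponents_le => n n_gt0 /le_N n_le n_deg.
  have n_bd : (0 < n <= N)%N by rewrite n_gt0.
  rewrite mem_cat mem_filter mem_iota add1n ltnS n_bd andbT.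
  case: ltP => //= Om_le.
  exact: (good_exponent_cases n_bd n_deg mE kE l_ge0 erefl erefl dom1 Om_le).
have s2_le : (size s2)%:R <= x * (2 * expR (- (delta' * l))).
  apply: size_rebuilt_exponents_le N_le _ _ dom2.
    by rewrite truncn_le expR_ge0.
  by rewrite ltW // truncnS_gt.
have s1_le : (size s1)%:R <= x * (expR B' * expR (- (delta' * l))).
  apply: le_trans (size_large_Omega_le (k * l) m.+1 N w_bd') _.
  have m_gt1 : (1 < m.+1)%N by rewrite ltnS (leq_trans _ m_ge3).
  have := prod_le m.+1 m_gt1; set P := \prod_(_ <- _ | _) _ => P_le.
  have m_ge2 : (2 <= m)%N by rewrite ltnW.
  have := ln_ln_succ_le e_gt0 m_ge2 lnm_ge1; rewrite -/l => ll_le.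
  rewrite mulrCA; apply: ler_pM; rewrite ?ler0n //.
    rewrite mulr_ge0 ?expR_ge0 //; apply: prodr_ge0 => p p_pr.
    have : 2 <= p%:R :> R by rewrite (ler_nat R 2) prime_gt1.
    by move=> ?; rewrite addr_ge0 // divr_ge0 //; lra.
  apply: le_trans (ler_wpM2l (expR_ge0 _) P_le) _.
  rewrite -!expRD ler_expR eE /B' /k.
  set lnw := ln w in t_le *; set z := ln _ in ll_le *; set c := ln (1 + 2 / e) in ll_le *.
  have : (w - 1) * (1 + t) * z <= (w - 1) * (1 + t) * (l + c).
    by apply: ler_wpM2l => //; rewrite mulr_ge0 //; lra.
  (* The choice of [t], multiplied by [l], sets the growth of the moment against the Markov factor
     and leaves [- delta' * l]. *)
  have : ((w - 1) * (1 + t) + delta') * l <= w * (1 - t) * lnw * l.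
    exact: ler_wpM2r.
  lra.
apply: (@le_trans _ _ ((size s1)%:R + (size s2)%:R)).
  by rewrite -natrD ler_nat.
have := mulr_ge0 (ltW el0_gt0) xel_ge0.
lra.
Qed.
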